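(* Let $k$ be a field, let $d\geq 2$, and let $V_d$ be a $d$-dimensional $k$-vector space with a fixed basis. Take $p_i\in V_d$ for $1\leq i\leq 2d$ and define $v_{i,j}=p_j-p_i$ for all $1\leq i<j\leq 2d$. Then $det^{S^2}((v_{i,j})_{1\leq i<j\leq 2d})=0$.
   Context: Let $\mathcal{B}_d=\{e_1,\dots,e_d\}$ be the fixed basis of $V_d$; vectors of $V_d$ are written as column vectors in $k^d$ with respect to it. An element of $V_d^{d(2d-1)}$ is a family $(v_{i,j})_{1\leq i<j\leq 2d}$ of vectors of $V_d$ indexed by the $d(2d-1)$ pairs $1\leq i<j\leq 2d$. For each $1\leq r\leq 2d$ let $M_r$ be the $d\times d(2d-1)$ matrix whose columns are indexed by the pairs $(i,j)$ with $1\le i<j\le 2d$, listed in the order $(1,2),(1,3),(2,3),(1,4),(2,4),(3,4),(1,5),\dots$ (ordered by $j$ first and then by $i$), where the column indexed by $(s,r)$ with $s<r$ is $(-1)^{s-1}v_{s,r}$, the column indexed by $(r,t)$ with $t>r$ is $(-1)^t v_{r,t}$, and all other columns are $0$. Let $A_1((v_{i,j})_{1\leq i<j\leq 2d})$ be the square $d(2d-1)\times d(2d-1)$ matrix obtained by stacking $M_2,M_3,\dots,M_{2d}$ on top of each other in this order. The map $det^{S^2}:V_d^{d(2d-1)}\to k$ is defined by $det^{S^2}((v_{i,j})_{1\leq i<j\leq 2d})=\det\big(A_1((v_{i,j})_{1\leq i<j\leq 2d})\big)$. *)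

(* Defs.v *)
From mathcomp Require Import all_boot all_order all_algebra.

Set Implicit Arguments.
Unset Strict Implicit.
Unset Printing Implicit Defensive.

Import GRing.Theory.
Local Open Scope ring_scope.

(* Vertices 1, ..., n are represented by 'I_n, hence shifted down by one:     *)
(* i : 'I_n stands for the vertex i.+1.                                       *)
Definition edge (n : nat) : predArgType :=
  {ij : 'I_n * 'I_n | (ij.1 < ij.2)%N}.

Definition src n (ij : edge n) : 'I_n := (val ij).1.
Definition tgt n (ij : edge n) : 'I_n := (val ij).2.

(* The order (1,2), (1,3), (2,3), (1,4), ...: by j first, then by i; insub    *)
(* discards the pairs with i >= j.                                            *)
Definition edges (n : nat) : seq (edge n) :=
  pmap insub [seq (i, j) | j <- enum 'I_n, i <- enum 'I_n].

Lemma size_edges n : size (edges n) = 'C(n, 2).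
Proof.
rewrite /edges size_pmap_sub count_flatten -map_comp.
under eq_map => j do
  rewrite /= count_map -sum1_count big_enum_cond /=
    -(big_ord_widen_cond n xpredT (fun=> 1%N) (ltnW (ltn_ord j)))
    sum1_card card_ord.
by rewrite sumnE big_map big_enum -bin2_sum big_mkord.
Qed.

Lemma size_edges_double d : size (edges (2 * d)) == (d * (2 * d - 1))%N.
Proof. by rewrite size_edges bin2 -mulnA mul2n doubleK subn1. Qed.

Definition edge_tuple d : (d * (2 * d - 1)).-tuple (edge (2 * d)) :=
  Tuple (size_edges_double d).

Lemma sum_rows d : (\sum_(i < 2 * d - 1) d)%N = (d * (2 * d - 1))%N.
Proof. by rewrite sum_nat_const card_ord mulnC. Qed.

Section DetS2.

Variables (k : fieldType) (d : nat) (V : vectType k) (e : d.-tuple V).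

Definition coord_col (x : V) : 'cV[k]_d := \col_i coord e i x.

(* r is the 1-based index of the matrix M_r, so it is compared with the       *)
(* successors of the 0-based end points of the edge.                          *)
Definition M_col (v : edge (2 * d) -> V) (r : nat) (ij : edge (2 * d)) :
    'cV[k]_d :=
  if r == (tgt ij).+1 then (-1) ^+ src ij *: coord_col (v ij)
  else if r == (src ij).+1 then (-1) ^+ (tgt ij).+1 *: coord_col (v ij)
  else 0.

Definition M (v : edge (2 * d) -> V) (r : nat) : 'M[k]_(d, d * (2 * d - 1)) :=
  \matrix_(a, c) M_col v r (tnth (edge_tuple d) c) a 0.

Definition A1 (v : edge (2 * d) -> V) : 'M[k]_(d * (2 * d - 1)) :=
  castmx (sum_rows d, erefl) (\mxcol_(i < 2 * d - 1) M v i.+2).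

Definition detS2 (v : edge (2 * d) -> V) : k := \det (A1 v).

End DetS2.

(* Main.v *)
Require Import Defs.
From mathcomp Require Import all_boot all_order all_algebra.
Import GRing.Theory.
Local Open Scope ring_scope.

(** Up to signs of rows and columns, the matrix [A1] of a family of differences
    [p_j - p_i] is the transpose of the rigidity matrix of the complete graph on
    the points [p_1, ..., p_2d], with the block of the vertex [1] deleted: a
    relation between its rows is a velocity [u_r] at each vertex, vanishing at
    the first one, such that [u_j - u_i] is orthogonal to [p_j - p_i] for every
    edge ([detS2_eq0_of_motion]).

    Infinitesimal rotations about the first point are such motions: if [B] is an
    alternating matrix, then [u_r = B (p_r - p_1)] works, since
    [x^T B x = 0] for all [x] ([alternating_delta]).  As [d >= 2], there is an
    alternating [B] that does not kill a given nonzero vector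
    ([alternating_delta_neq0]), so one of these motions is nonzero as soon as the
    points do not all have the same coordinates.  If they do, every edge vector
    is zero and any motion will do.  In both cases the rows of [A1] are dependent. *)

Lemma det_castmx_eq0 (k : fieldType) (m n : nat) (eq_mn : m = n)
    (X : 'M[k]_(m, n)) (y : 'rV[k]_m) :
  y != 0 -> y *m X = 0 -> \det (castmx (eq_mn, erefl) X) = 0.
Proof.
case: n / eq_mn X => X y0 yX; rewrite castmx_id.
by apply/eqP/det0P; exists y.
Qed.

Lemma sum_ord_shift (W : nmodType) (n : nat) (f : nat -> W) :
  (0 < n)%N -> f 0%N = 0 -> \sum_(i < n - 1) f i.+1 = \sum_(i < n) f i.
Proof.
by case: n => // n _ f0; rewrite big_ord_recl /= f0 add0r subn1.
Qed.

(** The factors [(-1) ^+ r] make the two nonzero blocks of a column carry the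
    edge vector with opposite signs.  The sum includes the vertex [0], which has
    no block in [A1], so that the two end points play symmetric roles. *)
Lemma sum_M_col (k : fieldType) (d : nat) (V : vectType k) (e : d.-tuple V)
    (v : edge (2 * d) -> V) (u : nat -> 'rV[k]_d) (ij : edge (2 * d)) :
  \sum_(r < 2 * d) (-1) ^+ r *: (u r *m M_col e v r.+1 ij) =
  (-1) ^+ (tgt ij + src ij) *:
    ((u (tgt ij) - u (src ij)) *m coord_col e (v ij)).
Proof.
have lt_st : (src ij < tgt ij)%N by exact: (valP ij).
have ne_st : src ij != tgt ij by rewrite -val_eqE /= ltn_eqF.
rewrite (bigD1 (tgt ij)) //= (bigD1 (src ij)) //= big1 ?addr0 => [|r].
  rewrite /M_col !eqSS !eqxx (ltn_eqF lt_st) -!scalemxAr !scalerA.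
  by rewrite -!exprD addnS exprS mulN1r addnC scaleNr mulmxBl scalerBr addnC.
rewrite -!val_eqE /= => /andP[r_t r_s].
by rewrite /M_col !eqSS (negPf r_t) (negPf r_s) mulmx0 scaler0.
Qed.

(** An infinitesimal motion [u] that fixes the first vertex, moves some
    vertex and does not stretch any edge is, up to signs, a nonzero vector of
    the left kernel of [A1]. *)
Lemma detS2_eq0_of_motion (k : fieldType) (d : nat) (V : vectType k)
    (e : d.-tuple V) (v : edge (2 * d) -> V) (u : nat -> 'rV[k]_d) (r : nat) :
  u 0%N = 0 -> (r < 2 * d)%N -> u r != 0 ->
  (forall ij, (u (tgt ij) - u (src ij)) *m coord_col e (v ij) = 0) ->
  detS2 e v = 0.
Proof.
move=> u0 lt_r ur_n0 uv.
have r_gt0 : (0 < r)%N by case: r ur_n0 {lt_r} => //; rewrite u0 eqxx.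
pose y (i : 'I_(2 * d - 1)) : 'rV[k]_d := (-1) ^+ i.+1 *: u i.+1.
apply: (@det_castmx_eq0 _ _ _ _ _ (\mxrow_i y i)).
  have lt_r1 : (r.-1 < 2 * d - 1)%N by rewrite subn1 ltn_predRL prednK.
  apply: contra ur_n0 => /eqP y_0.
  have := mxrowK y (Ordinal lt_r1); rewrite y_0 submxrow0 /y /= prednK //.
  by move/esym/eqP; rewrite scaler_eq0 signr_eq0.
rewrite mul_mxrow_mxcol; apply/rowP => c; rewrite summxE mxE.
set ij := tnth (edge_tuple d) c.
pose f s : 'M[k]_1 := (-1) ^+ s *: (u s *m M_col e v s.+1 ij).
have -> : \sum_i (y i *m M e v i.+2) 0 c = (\sum_(i < 2 * d - 1) f i.+1) 0 0.
  rewrite summxE; apply: eq_bigr => i _; rewrite /f scalemxAl !mxE.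
  by apply: eq_bigr => a _; rewrite [M _ _ _ _ _]mxE.
rewrite sum_ord_shift ?(leq_trans _ lt_r) //; last first.
  by rewrite /f u0 mul0mx scaler0.
by rewrite sum_M_col uv scaler0 mxE.
Qed.

(** The matrix [delta_mx a b - delta_mx b a] generates the rotations of the
    coordinate plane [(a, b)]; its quadratic form vanishes in every
    characteristic. *)
Lemma alternating_delta (k : fieldType) (d : nat) (a b : 'I_d) (w : 'cV[k]_d) :
  w^T *m (delta_mx a b - delta_mx b a) *m w = 0.
Proof.
rewrite mulmxBr mulmxBl; apply/eqP; rewrite subr_eq0; apply/eqP.
(* The two terms are transposes of each other, and have size 1. *)
have -> : w^T *m delta_mx b a *m w = (w^T *m delta_mx a b *m w)^T.
  by rewrite !trmx_mul trmxK trmx_delta mulmxA.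
by apply/matrixP => i j; rewrite [RHS]mxE !ord1.
Qed.

Lemma alternating_delta_neq0 (k : fieldType) (d : nat) (a b : 'I_d)
    (w : 'cV[k]_d) :
  a != b -> w a 0 != 0 -> w^T *m (delta_mx a b - delta_mx b a) != 0.
Proof.
move=> ne_ab; apply: contraNneq => /rowP/(_ b); rewrite !mxE (bigD1 a) //= big1.
  by rewrite !mxE !eqxx (negPf ne_ab) subr0 mulr1 addr0 => ->.
move=> c ne_ca; rewrite !mxE (negPf ne_ca) [b == a]eq_sym (negPf ne_ab).
by rewrite andbF subrr mulr0.
Qed.

Lemma coord_colB (k : fieldType) (d : nat) (V : vectType k) (e : d.-tuple V)
    (x y : V) : coord_col e (x - y) = coord_col e x - coord_col e y.
Proof. by apply/colP => i; rewrite !mxE linearB. Qed.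

Theorem corollary4p1 (k : fieldType) (d : nat) (hd : (2 <= d)%N)
    (V : vectType k) (e : d.-tuple V) (he : basis_of fullv e)
    (p : 'I_(2 * d) -> V) :
  detS2 e (fun ij => p (tgt ij) - p (src ij)) = 0.
Proof.
(* Points are indexed by [nat], like motions; 0 is a default out of range. *)
pose x (r : nat) : 'cV[k]_d := coord_col e (oapp p 0 (insub r)).
have xE (i : 'I_(2 * d)) : coord_col e (p i) = x i by rewrite /x valK.
have d_gt0 : (0 < d)%N by exact: ltnW.
have lt_1 : (1 < 2 * d)%N by rewrite mul2n -addnn (leq_trans hd) ?leq_addr.
have [/forallP x_const | ] :=
  boolP [forall r : 'I_(2 * d), x r - x 0%N == 0].
  pose a := Ordinal d_gt0.
  apply: (@detS2_eq0_of_motion _ _ _ _ _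
            (fun r => if r == 1%N then delta_mx 0 a else 0) 1) => //=.
    by apply/eqP => /rowP/(_ a)/eqP; rewrite !mxE !eqxx oner_eq0.
  move=> ij; rewrite coord_colB !xE.
  have x0 (r : 'I_(2 * d)) : x r = x 0%N.
    by apply/eqP; rewrite -subr_eq0; exact: x_const.
  by rewrite !x0 subrr mulmx0.
rewrite negb_forall => /existsP[r xr_n0].
have /existsP[a xra_n0] : [exists a, (x r - x 0%N) a 0 != 0].
  rewrite -negb_forall; apply: contra xr_n0 => /forallP q0.
  by apply/eqP/colP => a; rewrite (eqP (q0 a)) mxE.
have [b ne_ab] : exists b : 'I_d, a != b.
  have [a0 | a_n0] := eqVneq (a : nat) 0%N.
    by exists (Ordinal hd); rewrite -val_eqE /= a0.
  by exists (Ordinal d_gt0).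
apply: (@detS2_eq0_of_motion _ _ _ _ _
          (fun s => (x s - x 0%N)^T *m (delta_mx a b - delta_mx b a)) r) => //.
- by rewrite subrr trmx0 mul0mx.
- exact: alternating_delta_neq0.
move=> ij; rewrite coord_colB !xE -mulmxBl -linearB /= opprB addrA subrK.
exact: alternating_delta.
Qed.
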